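(* Let $\lambda$ be a nonzero real number. For integers $n\ge 0$ let $(x)_{0,\mu}=1$ and $(x)_{n,\mu}=x(x-\mu)\cdots(x-(n-1)\mu)$ for $n\ge1$, for any nonzero parameter $\mu$, and let $(x)_n=x(x-1)\cdots(x-n+1)$, $(x)_0=1$. Define the degenerate Stirling numbers of the second kind ${n \brace k}_{\lambda}$ by $(x)_{n,\lambda}=\sum_{k=0}^{n}{n \brace k}_{\lambda}(x)_{k}$. Define the degenerate Eulerian polynomials with parameter $\mu$ by $\sum_{j=0}^{\infty}(j+1)_{n,\mu}x^{j}=\frac{A_{n,\mu}(x)}{(1-x)^{n+1}}$ for $|x|<1$, and the degenerate Eulerian numbers by $A_{n,\mu}(x)=\sum_{k=0}^{n}A_{\mu}(n,k)x^{k}$. Then for $n\ge k\ge0$, \[{n \brace k}_{\lambda}=\frac{1}{k!}\sum_{j=0}^{n}A_{-\lambda}(n,j)\binom{j}{n-k}.\]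
   Context: $A_{-\lambda}(n,j)$ is the degenerate Eulerian number with parameter $\mu=-\lambda$. *)

(* Defs.v *)
From HB Require Import structures.
From mathcomp Require Import all_boot all_order all_algebra.
From mathcomp Require Import all_classical all_reals all_analysis.

Set Implicit Arguments.
Unset Strict Implicit.
Unset Printing Implicit Defensive.

Import Order.TTheory GRing.Theory Num.Theory.
Import numFieldNormedType.Exports.

Local Open Scope classical_set_scope.
Local Open Scope ring_scope.

(* (x)_{n,mu} = x (x - mu) ... (x - (n-1) mu) *)
Definition deg_falling (R : realType) (mu x : R) (n : nat) : R :=
  \prod_(i < n) (x - i%:R * mu).

(* (x)_n = x (x - 1) ... (x - n + 1); the library's [n ^_ m] is for naturals
   only. *)
Definition falling (R : realType) (x : R) (n : nat) : R :=
  \prod_(i < n) (x - i%:R).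

(* [s k] is the coefficient of (x)_k in (x)_{n,lambda}, with [s k = 0] for
   k > n.  Since ((x)_k)_k is a basis of the polynomials in x, with (x)_k of
   degree k, exactly one [s] has this property. *)
Definition is_deg_stirling2 (R : realType) (lambda : R) (n : nat)
    (s : nat -> R) : Prop :=
  (forall x : R, deg_falling lambda x n = \sum_(k < n.+1) s k * falling x k)
  /\ (forall k : nat, (n < k)%N -> s k = 0).

Definition deg_stirling2 (R : realType) (lambda : R) (n : nat) : nat -> R :=
  xget (fun=> 0) [set s : nat -> R | is_deg_stirling2 lambda n s].

(* The size bound says that [A] has the form \sum_(k <= n) a_k x^k.  The
   numbers (j+1)_{n,mu} are the values at j of a polynomial of degree n, so
   exactly one [A] has this property. *)
Definition is_deg_eulerian_poly (R : realType) (mu : R) (n : nat)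
    (A : {poly R}) : Prop :=
  (size A <= n.+1)%N /\
  forall x : R, `|x| < 1 ->
    series (fun j : nat => deg_falling mu j.+1%:R n * x ^+ j) @ \oo
      --> A.[x] / (1 - x) ^+ n.+1.

Definition deg_eulerian_poly (R : realType) (mu : R) (n : nat) : {poly R} :=
  xget 0 [set A : {poly R} | is_deg_eulerian_poly mu n A].

Definition deg_eulerian (R : realType) (mu : R) (n k : nat) : R :=
  (deg_eulerian_poly mu n)`_k.

(* Main.v *)
(** Since [(x)_{n,-lambda} = (-1)^n (-x)_{n,lambda}], expanding in falling
    factorials gives
    [(j+1)_{n,-lambda} = \sum_k (-1)^(n-k) s_k k! 'C(j+k, k)], with [s] the
    degenerate Stirling numbers.  As [\sum_j 'C(j+k, k) x^j = (1-x)^-(k+1)], the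
    degenerate Eulerian polynomial with parameter [-lambda] is
    [\sum_k s_k k! (x-1)^(n-k)], and the claim reads off its Taylor
    coefficients at 1. *)
Require Import Defs.
From HB Require Import structures.
From mathcomp Require Import all_boot all_order all_algebra.
From mathcomp Require Import all_classical all_reals all_analysis.
From mathcomp Require Import ring zify.

Set Implicit Arguments.
Unset Strict Implicit.
Unset Printing Implicit Defensive.

Import Order.TTheory GRing.Theory Num.Theory.
Import numFieldNormedType.Exports.

Local Open Scope classical_set_scope.
Local Open Scope ring_scope.

Lemma deg_stirling2_exists (R : realType) (lambda : R) (n : nat) :
  exists s, is_deg_stirling2 lambda n s.
Proof.
elim: n => [|n [s [sE s0]]].
  exists (fun k => (k == 0%N)%:R); split=> [x|[]//].
  by rewrite /deg_falling big_ord_recl !big_ord0 /falling big_ord0 mul1r addr0.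
(* Multiplying [falling x k] by [x - n%:R * lambda = (x - k%:R) + (k%:R - n%:R * lambda)] raises the
   index by one or rescales, which gives this triangular recurrence. *)
exists (fun k => (if k is k'.+1 then s k' else 0) + (k%:R - n%:R * lambda) * s k).
split=> [x|[//|k] nk]; last first.
  by rewrite !s0 ?mulr0 ?addr0 // (ltn_trans _ nk).
rewrite /deg_falling big_ord_recr /= -/(deg_falling lambda x n) sE.
under [RHS]eq_bigr do rewrite mulrDl.
(* The shifted sum has no term at index 0 and the other none at [n.+1], so both reduce to
   [k <= n]. *)
rewrite big_split /= [X in _ = X + _]big_ord_recl /= mul0r add0r.
rewrite [X in _ = _ + X]big_ord_recr /= (s0 n.+1) // mulr0 mul0r addr0.
rewrite -big_split mulr_suml; apply: eq_bigr => k _ /=.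
rewrite /falling big_ord_recr /=; ring.
Qed.

Lemma deg_stirling2P (R : realType) (lambda : R) (n : nat) :
  is_deg_stirling2 lambda n (deg_stirling2 lambda n).
Proof. by have := deg_stirling2_exists lambda n; exact: xgetPex. Qed.

Lemma deg_falling_opp (R : realType) (lambda x : R) (n : nat) :
  deg_falling (- lambda) x n = (-1) ^+ n * deg_falling lambda (- x) n.
Proof.
rewrite /deg_falling -[n in _ ^+ n]card_ord -prodrN.
by apply: eq_bigr => i _; ring.
Qed.

Lemma falling_oppS (R : realType) (j k : nat) :
  falling (- j.+1%:R : R) k = (-1) ^+ k * (k`! * 'C(j + k, k))%:R.
Proof.
elim: k => [|k IH]; first by rewrite /falling big_ord0 fact0 bin0 mulr1.
rewrite /falling big_ord_recr /= -/(falling _ k) IH.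
have -> : (k.+1`! * 'C(j + k.+1, k.+1) = (j + k).+1 * (k`! * 'C(j + k, k)))%N.
  by rewrite factS addnS mulnAC -mul_bin_diag /= -mulnA [(_ * k`!)%N]mulnC.
rewrite exprS [in RHS]natrM -addSn natrD; ring.
Qed.

Lemma deg_falling_bin (R : realType) (lambda : R) (n j : nat) :
  deg_falling (- lambda) j.+1%:R n =
    \sum_(k < n.+1) (-1) ^+ (n - k) * deg_stirling2 lambda n k * k`!%:R
                    * 'C(j + k, k)%:R.
Proof.
have [sE _] := deg_stirling2P lambda n.
rewrite deg_falling_opp sE mulr_sumr; apply: eq_bigr => k _.
have kn : (k <= n)%N by rewrite -ltnS.
(* Splitting [n] as [(n - k) + k] leaves two factors [(-1) ^+ k], which cancel. *)
rewrite falling_oppS -{1}(subnK kn) exprD natrM.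
have e : (-1) ^+ k * (-1) ^+ k = 1 :> R by rewrite -expr2 sqrr_sign.
ring: e.
Qed.

(** Pascal's rule makes the product telescope; the subtracted term is the boundary term of the
    truncation at [N]. *)
Lemma series_binS (R : realType) (x : R) (k N : nat) :
  (1 - x) * series (fun j => 'C(j + k.+1, k.+1)%:R * x ^+ j) N =
  series (fun j => 'C(j + k, k)%:R * x ^+ j) N - 'C(N + k, k.+1)%:R * x ^+ N.
Proof.
rewrite /series /=; elim: N => [|N IH].
  by rewrite !big_geq // bin_small // mul0r mulr0 subr0.
rewrite !big_nat_recr // mulrDr IH addnS addSn binS natrD exprS /=; ring.
Qed.

(** For nonnegative [x] the partial sums increase, and dropping the boundary term in [series_binS]
    bounds them by those for the previous [k]. *)
Lemma is_cvg_series_bin (R : realType) (x : R) (k : nat) : 0 <= x < 1 ->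
  cvgn (series (fun j => 'C(j + k, k)%:R * x ^+ j)).
Proof.
case/andP=> x0 x1; elim: k => [|k IH].
  have -> : (fun j => 'C(j + 0, 0)%:R * x ^+ j) = geometric 1 x.
    by apply/funext => j; rewrite bin0.
  by apply: is_cvg_geometric_series; rewrite ger0_norm.
have pos i j m : 0 <= 'C(i, j)%:R * x ^+ m by rewrite mulr_ge0 ?exprn_ge0.
apply: nondecreasing_is_cvgn.
  by apply/nondecreasing_series => i _ _; exact: pos.
have [M [_ MP]] := cvg_seq_bounded IH.
(* The bound [MP] holds only for numbers strictly above [M], hence [M + 1]. *)
exists ((M + 1) / (1 - x)) => _ [N _ <-].
rewrite ler_pdivlMr ?subr_gt0 // mulrC series_binS.
rewrite (le_trans _ (MP (M + 1) _ N I)) ?ltrDl //.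
by rewrite (le_trans _ (ler_norm _)) // lerBlDr lerDl.
Qed.

Lemma cvg_series_bin (R : realType) (x : R) (k : nat) : `|x| < 1 ->
  series (fun j => 'C(j + k, k)%:R * x ^+ j) @ \oo --> (1 - x) ^- k.+1.
Proof.
move=> x1.
have x_neq1 : 1 - x != 0.
  by rewrite subr_eq0; apply: contraTneq x1 => <-; rewrite normr1 ltxx.
elim: k => [|k IH].
  have -> : (fun j => 'C(j + 0, 0)%:R * x ^+ j) = geometric 1 x.
    by apply/funext => j; rewrite bin0.
  by rewrite expr1 -[_^-1]mul1r; exact: cvg_geometric_series.
(* Convergence at [|x|] forces the terms to 0, and these dominate the boundary term of
   [series_binS]. *)
have /cvg_series_cvg_0 h : cvgn (series (fun j => 'C(j + k.+1, k.+1)%:R * `|x| ^+ j)).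
  by apply: is_cvg_series_bin; rewrite normr_ge0.
have h0 : 'C(N + k, k.+1)%:R * x ^+ N @[N --> \oo] --> (0 : R).
  apply: (@norm_cvg0 _ R^o).
  apply: squeeze_cvgr h; last exact: cvg_cst.
  apply: nearW => N; rewrite normr_ge0 normrM normrX normr_nat.
  by rewrite ler_wpM2r ?exprn_ge0 // ler_nat addnS leq_bin2l.
have -> : series (fun j => 'C(j + k.+1, k.+1)%:R * x ^+ j) =
  (fun N => (1 - x)^-1 *
    (series (fun j => 'C(j + k, k)%:R * x ^+ j) N - 'C(N + k, k.+1)%:R * x ^+ N)).
  by apply/funext => N; rewrite -series_binS mulKf.
have -> : (1 - x) ^- k.+2 = (1 - x)^-1 * ((1 - x) ^- k.+1 - 0).
  by rewrite subr0 exprS invfM.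
by apply: cvgMr; exact: cvgB.
Qed.

Lemma deg_eulerian_poly_unique (R : realType) (mu : R) (n : nat)
    (A B : {poly R}) :
  is_deg_eulerian_poly mu n A -> is_deg_eulerian_poly mu n B -> A = B.
Proof.
move=> [_ cA] [_ cB]; apply/eqP; rewrite -subr_eq0; apply: contraT => AB0.
(* These are [size (A - B)] distinct points of (0, 1), more than the degree of [A - B]; the common
   limit makes each one a root. *)
pose rs := [seq (i.+2%:R^-1 : R) | i <- iota 0 (size (A - B)%R)].
have urs : uniq rs.
  rewrite map_inj_uniq ?iota_uniq // => i j /invr_inj /eqP.
  by rewrite eqr_nat => /eqP[].
have /(max_poly_roots AB0)/(_ urs) : all (root (A - B)) rs.
  apply/allP => _ /mapP[i _ ->]; set x := _^-1.
  have x1 : `|x| < 1.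
    by rewrite ger0_norm ?invr_ge0 // invf_lt1 // ltr1n.
  have x_neq1 : (1 - x) ^+ n.+1 != 0.
    by rewrite expf_neq0 // subr_eq0; apply: contraTneq x1 => <-; rewrite normr1 ltxx.
  have : A.[x] / (1 - x) ^+ n.+1 = B.[x] / (1 - x) ^+ n.+1.
    by apply: (cvg_unique (@norm_hausdorff _ R^o)) (cA x x1) (cB x x1).
  by move/(mulIf (invr_neq0 x_neq1)) => e; rewrite rootE !hornerE e subrr.
by rewrite size_map size_iota ltnn.
Qed.

Lemma is_deg_eulerian_poly_opp (R : realType) (lambda : R) (n : nat) :
  is_deg_eulerian_poly (- lambda) n
    (\sum_(k < n.+1)
       (deg_stirling2 lambda n k * k`!%:R) *: ('X - 1%:P) ^+ (n - k)).
Proof.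
split=> [|x x1].
  apply: (leq_trans (size_sum _ _ _)); apply/bigmax_leqP => k _.
  by rewrite (leq_trans (size_scale_leq _ _)) // size_exp_XsubC ltnS leq_subr.
have x_neq1 : 1 - x != 0.
  by rewrite subr_eq0; apply: contraTneq x1 => <-; rewrite normr1 ltxx.
pose c (k : nat) : R := (-1) ^+ (n - k) * deg_stirling2 lambda n k * k`!%:R.
have -> : series (fun j => deg_falling (- lambda) j.+1%:R n * x ^+ j) =
  (fun N => \sum_(k < n.+1)
     c k * series (fun j => 'C(j + k, k)%:R * x ^+ j) N).
  apply/funext => N; rewrite /series /=.
  under eq_bigr do rewrite deg_falling_bin mulr_suml.
  rewrite exchange_big /=; apply: eq_bigr => k _.
  by rewrite mulr_sumr; apply: eq_bigr => j _; rewrite mulrA.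
rewrite horner_sum mulr_suml; apply: cvg_big => [|k _]; first exact: add_continuous.
have kn : (k <= n)%N by rewrite -ltnS.
rewrite (_ : _.[x] / _ = c k * (1 - x) ^- k.+1).
  by apply: cvgMr; exact: cvg_series_bin.
(* The sign in [c k] turns [(x - 1) ^+ (n - k)] into [(1 - x) ^+ (n - k)], which cancels against the
   denominator and leaves exponent [k.+1]. *)
rewrite !hornerE /c -[x - 1]opprB -(mulN1r (1 - x)) exprMn -[in X in _ / X](subnK kn) -addnS exprD.
by field; rewrite !expf_neq0.
Qed.

Lemma deg_eulerian_polyE (R : realType) (mu : R) (n : nat) (A : {poly R}) :
  is_deg_eulerian_poly mu n A -> deg_eulerian_poly mu n = A.
Proof.
move=> AP; apply: deg_eulerian_poly_unique (AP).
exact: (xgetPex _ (ex_intro _ A AP)).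
Qed.

(** By the binomial theorem, both sides are the Taylor coefficient of [p] at 1 of order [m]. *)
Lemma sum_coef_bin (R : comNzRingType) (p : {poly R}) (n m : nat) :
  (size p <= n)%N -> \sum_(j < n) p`_j * 'C(j, m)%:R = (p \Po ('X + 1))`_m.
Proof.
move=> pn.
have {2}-> : p = \sum_(j < n) p`_j *: 'X^j.
  rewrite -poly_def; apply/polyP => i; rewrite coef_poly.
  by case: ltnP => // ni; rewrite nth_default // (leq_trans pn).
rewrite raddf_sum coef_sum; apply: eq_bigr => j _ /=.
rewrite comp_polyZ coefZ rmorphXn /= comp_polyX exprD1n; congr (_ * _).
under eq_bigr do rewrite -scaler_nat.
rewrite -(poly_def _ (fun i => 'C(j, i)%:R)) coef_poly.
by case: ltnP => // /bin_small ->.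
Qed.

Theorem theorem2p8 (R : realType) (lambda : R) (hlambda : lambda != 0)
    (n k : nat) (hkn : (k <= n)%N) :
  deg_stirling2 lambda n k =
    1 / k`!%:R * \sum_(j < n.+1) deg_eulerian (- lambda) n j * 'C(j, n - k)%:R.
Proof.
have kf : k`!%:R != 0 :> R by rewrite pnatr_eq0 -lt0n fact_gt0.
have AP := is_deg_eulerian_poly_opp lambda n.
rewrite /deg_eulerian (deg_eulerian_polyE AP) sum_coef_bin; last exact: AP.1.
(* The shift turns [('X - 1%:P) ^+ (n - i)] into a monomial of degree [n - i]; as [i] and [k] are at
   most [n], this equals [n - k] only for [i = k]. *)
have E (i : 'I_n.+1) :
  (((deg_stirling2 lambda n i * i`!%:R) *: ('X - 1%:P) ^+ (n - i))
     \Po ('X + 1))`_(n - k) =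
  deg_stirling2 lambda n i * i`!%:R * (i == k :> nat)%:R.
  rewrite comp_polyZ coefZ rmorphXn rmorphB /= comp_polyX comp_polyC addrK coefXn.
  by congr (_ * _%:R); have := ltn_ord i; lia.
rewrite raddf_sum coef_sum (eq_bigr _ (fun i _ => E i)).
rewrite (bigD1 (inord k)) //= inordK // eqxx big1 => [|i].
  by rewrite /= mulr1 addr0; field.
by rewrite -val_eqE /= inordK // => /negPf ->; rewrite mulr0.
Qed.
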